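(* The following two assertions are equivalent. (A) Every polynomial map $f: \mathbb{C}^2 \to \mathbb{C}^2$ whose Jacobian determinant is a nonzero constant is bijective and has a polynomial inverse. (B) For every polynomial map $f: \mathbb{C}^2 \to \mathbb{C}^2$ whose Jacobian determinant is a nonzero constant, and every cofinite subset $\Omega \subseteq \mathbb{C}^2$ with $f(\Omega) = \Omega$, the restriction $f|_{\Omega}$ is injective.
   Context: A subset of $\mathbb{C}^2$ is cofinite if its complement in $\mathbb{C}^2$ is finite. *)

(* Defs.v *)
From HB Require Import structures.
From mathcomp Require Import all_boot all_order all_algebra.
From mathcomp Require Import reals.
From mathcomp Require Import complex.
From mathcomp Require Import mpoly.
Set Implicit Arguments. Unset Strict Implicit. Unset Printing Implicit Defensive.
Import Order.TTheory GRing.Theory Num.Theory.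
Local Open Scope ring_scope.

(* For R : realType (unique up to isomorphism: the real numbers),
   the field of complex numbers is R[i] = complex R (used below). *)

Definition polymap (R : realType) := 'I_2 -> {mpoly R[i][2]}.

Definition pt (R : realType) := (R[i] * R[i])%type.

Definition coords (R : realType) (z : pt R) : 'I_2 -> R[i] :=
  fun k => if k == ord0 then z.1 else z.2.

Definition evalmap (R : realType) (f : polymap R) (z : pt R) : pt R :=
  ((f ord0).@[coords z], (f (@Ordinal 2 1 isT)).@[coords z]).

Definition jacobian (R : realType) (f : polymap R) : {mpoly R[i][2]} :=
  \det (\matrix_(i < 2, j < 2) mderiv j (f i)).

Definition jac_nonzero_const (R : realType) (f : polymap R) : Prop :=
  exists c : R[i], c != 0 /\ jacobian f = c%:MP.

Definition bij_with_poly_inverse (R : realType) (f : polymap R) : Prop :=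
  bijective (evalmap f) /\
  exists g : polymap R,
    cancel (evalmap f) (evalmap g) /\ cancel (evalmap g) (evalmap f).

Definition cofinite (R : realType) (Om : pt R -> Prop) : Prop :=
  exists s : seq (pt R), forall z, ~ Om z -> z \in s.

Definition image_eq (R : realType) (F : pt R -> pt R) (Om : pt R -> Prop) : Prop :=
  forall z, Om z <-> exists w, Om w /\ F w = z.

Definition injective_on (R : realType) (F : pt R -> pt R) (Om : pt R -> Prop) : Prop :=
  forall z w, Om z -> Om w -> F z = F w -> z = w.

Definition assertionA (R : realType) : Prop :=
  forall f : polymap R, jac_nonzero_const f -> bij_with_poly_inverse f.

Definition assertionB (R : realType) : Prop :=
  forall (f : polymap R) (Om : pt R -> Prop),
    jac_nonzero_const f -> cofinite Om -> image_eq (evalmap f) Om ->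
    injective_on (evalmap f) Om.

(* Main.v *)
Require Import Defs.
From HB Require Import structures.
From mathcomp Require Import all_boot all_order all_algebra.
From mathcomp Require Import reals complex mpoly.
From mathcomp Require Import boolp zify ring.

(* For (B) -> (A), let f be a map with constant nonzero Jacobian.  Its fibres are
   finite, for a curve in a fibre would be a common factor of the two shifted
   components.  After a generic shear, eliminating y from f(x, y) = (a, b) gives
   R(x; a, b) whose roots in x are the abscissas of the points over (a, b).  The
   points missed by f are the common zeros of the coefficients of R of positive
   degree in x, and they are finitely many.

   If only finitely many values are taken more than once, R is generically a
   power of a linear polynomial in x, so x is a rational function of f, and a
   polynomial one because f misses only finitely many points; f is then invertible.

   Otherwise let s_1, ..., s_n be the missed points and p_1, ..., p_n preimages
   of distinct values, each also taken at some q_i outside {p_1, ..., p_n}.  A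
   composite phi of shears sends s_i to p_i, and g = f o phi maps the complement
   Omega of {s_1, ..., s_n} onto itself, the value lost at s_i being recovered from
   q_i.  But g is not injective on Omega, contradicting (B). *)

Set Implicit Arguments. Unset Strict Implicit. Unset Printing Implicit Defensive.
Import Order.TTheory GRing.Theory Num.Theory.
Local Open Scope ring_scope.

(** * Finite sets, given as predicates contained in a list, and minimal choices *)

Definition listable (T : eqType) (Z : T -> Prop) : Prop :=
  exists s : seq T, forall z, Z z -> z \in s.

Lemma listable_sub (T : eqType) (Y Z : T -> Prop) :
  (forall z, Y z -> Z z) -> listable Z -> listable Y.
Proof. by move=> YZ [s Zs]; exists s => z /YZ /Zs. Qed.

Lemma listableU (T : eqType) (Y Z : T -> Prop) :
  listable Y -> listable Z -> listable (fun z => Y z \/ Z z).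
Proof.
move=> [s Ys] [t Zt]; exists (s ++ t) => z.
by rewrite mem_cat => -[/Ys-> // | /Zt->]; rewrite orbT.
Qed.

Lemma unlistable_notin (T : eqType) (Z : T -> Prop) (s : seq T) :
  ~ listable Z -> exists2 z, Z z & z \notin s.
Proof.
move=> Zinf; case: (pselect (exists2 z, Z z & z \notin s)) => // Zs.
case: Zinf; exists s => z Zz; apply: contra_notT Zs => zs; by exists z.
Qed.

Lemma exists_minimal (T : Type) (I : T -> Prop) (m : T -> nat) :
  (exists x, I x) -> exists2 x, I x & forall y, I y -> (m x <= m y)%N.
Proof.
move=> [x Ix].
have ex: exists n, `[< exists2 y, I y & m y = n >].
  by exists (m x); apply/asboolP; exists x.
case: (ex_minnP ex) => n /asboolP [y Iy <-] nmin.
by exists y => // z Iz; apply: nmin; apply/asboolP; exists z.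
Qed.

Lemma unlistable_uniq (T : eqType) (Z : T -> Prop) n : ~ listable Z ->
  exists s : seq T, [/\ uniq s, size s = n & forall z, z \in s -> Z z].
Proof.
move=> Zinf; elim: n => [|n [s [us <- sZ]]]; first by exists [::].
have [z Zz zs] := unlistable_notin s Zinf; exists (z :: s); split=> //=.
  by rewrite zs.
by move=> y /predU1P[->|/sZ].
Qed.

(** * Polynomials in two variables as functions on the plane *)

Section Plane.
Variable K : numClosedFieldType.
Implicit Types (z w : K * K) (P Q p q r h : {poly {poly K}}) (R : {poly {poly {poly K}}}).

(* The outer variable of [{poly {poly K}}] is the second coordinate. *)
Definition ev z : {poly {poly K}} -> K :=
  horner_eval z.1 \o horner_eval z.2%:P.
HB.instance Definition _ z := GRing.RMorphism.on (ev z).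

Lemma evE z p : ev z p = p.[z.2%:P].[z.1].
Proof. by []. Qed.

Lemma evC z (c : {poly K}) : ev z c%:P = c.[z.1].
Proof. by rewrite evE hornerC. Qed.

Lemma evX z : ev z 'X = z.2.
Proof. by rewrite evE hornerX hornerC. Qed.

Lemma ev_row (x y : K) p : ev (x, y) p = (map_poly (horner_eval x) p).[y].
Proof.
by rewrite evE -[in RHS](hornerC y x) -[(y%:P).[x]]/(horner_eval x y%:P) horner_map.
Qed.

Lemma evB z : {morph ev z : p q / p - q}. Proof. exact: rmorphB. Qed.
Lemma evD z : {morph ev z : p q / p + q}. Proof. exact: rmorphD. Qed.
Lemma evN z : {morph ev z : p / - p}. Proof. exact: rmorphN. Qed.
Lemma evM z : {morph ev z : p q / p * q}. Proof. exact: rmorphM. Qed.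

Definition ev_simp := (evC, evX, evB, evN, evD, evM, hornerX, hornerC).

Lemma nonroot_notin (p : {poly K}) (s : seq K) :
  p != 0 -> exists2 x, x \notin s & p.[x] != 0.
Proof.
move=> p0; have: p * \prod_(a <- s) ('X - a%:P) != 0.
  by rewrite mulf_neq0 // monic_neq0 // monic_prod_XsubC.
case/closed_nonrootP => x; rewrite rootM negb_or root_prod_XsubC => /andP[px xs].
by exists x.
Qed.

Lemma map_eval_eq0 p : (forall x, map_poly (horner_eval x) p = 0) -> p = 0.
Proof.
move=> p0; apply/polyP => j; rewrite coef0; apply/eqP; apply: contraT.
case/closed_nonrootP => x; rewrite rootE.
by rewrite -[_.[x]]/(horner_eval x _) -coef_map p0 coef0 eqxx.
Qed.

Lemma ev_eq0 p : (forall z, ev z p = 0) -> p = 0.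
Proof.
move=> p0; apply: map_eval_eq0 => x; apply/eqP; apply: contraT.
by case/closed_nonrootP => y; rewrite rootE -ev_row p0 eqxx.
Qed.

Lemma ev_neq0 p : p != 0 -> exists z, ev z p != 0.
Proof.
move=> p0; case: (pselect (exists z, ev z p != 0)) => // np.
case/eqP: p0; apply: ev_eq0 => z; apply/eqP; apply: contra_notT np; by exists z.
Qed.

(** Zariski density of the locus where [q] does not vanish: [p * q] vanishes on the whole plane, and
    the ring is a domain. *)
Lemma ev_eq0_dense p q : q != 0 ->
  (forall z, ev z q != 0 -> ev z p = 0) -> p = 0.
Proof.
move=> q0 pq; apply/eqP; have: p * q = 0; last first.
  by move/eqP; rewrite mulf_eq0 (negPf q0) orbF.
apply: ev_eq0 => z; rewrite evM; apply/eqP; rewrite mulf_eq0.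
by have [_|/pq->] := boolP (ev z q == 0); rewrite ?orbT ?eqxx.
Qed.

Lemma listable_ev_neq0 (Z : K * K -> Prop) :
  listable Z -> exists2 p, p != 0 & forall z, Z z -> ev z p = 0.
Proof.
(* The product of the horizontal lines through the listed points. *)
move=> [s Zs]; exists (\prod_(z <- s) ('X - z.2%:P%:P)).
  by rewrite -(big_map (fun z => z.2%:P) predT (fun a => 'X - a%:P))
    monic_neq0 // monic_prod_XsubC.
move=> z /Zs zs; rewrite rmorph_prod (big_rem z) //= ?ev_simp.
by rewrite subrr mul0r.
Qed.

(** * Zero sets and common factors *)

Definition is_const p := exists c : K, p = c%:P%:P.

(** A polynomial in the first variable alone vanishes on a vertical line; otherwise every abscissa
    that does not kill the leading coefficient carries a zero. *)
Lemma nonconst_zeros p (s : seq (K * K)) :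
  ~ is_const p -> exists2 z, ev z p = 0 & z \notin s.
Proof.
move=> pc; have [/size1_polyC pE|p1] := leqP (size p) 1.
  have: size p`_0 != 1.
    apply/negP => /eqP /eq_leq /size1_polyC p0E; apply: pc.
    by exists p`_0`_0; rewrite -p0E.
  case/closed_rootP => x /eqP px.
  have [|y ys _] := @nonroot_notin 1 (map snd s); first exact: oner_neq0.
  exists (x, y); first by rewrite pE evC.
  by apply: contra ys => xys; apply/mapP; exists (x, y).
have lp0: lead_coef p != 0 by rewrite lead_coef_eq0 -size_poly_gt0 ltnW.
have [x xs lpx] := nonroot_notin (map fst s) lp0.
have: size (map_poly (horner_eval x) p) != 1.
  rewrite size_poly_eq ?neq_ltn ?p1 ?orbT //.
case/closed_rootP => y /eqP pxy; exists (x, y); first by rewrite ev_row.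
by apply: contra xs => xys; apply/mapP; exists (x, y).
Qed.

Lemma nonconst_neq0 p : ~ is_const p -> p != 0.
Proof. by move=> pc; apply/eqP => p0; apply: pc; exists 0. Qed.

Lemma neq0_zero_nonconst p z : p != 0 -> ev z p = 0 -> ~ is_const p.
Proof.
move=> p0 pz [c pE]; move: p0 pz; rewrite pE !evC hornerC => + c0.
by rewrite c0 eqxx.
Qed.

Lemma map_eval_dvd (x : K) p : map_poly (horner_eval x) p = 0 ->
  exists q, p = q * ('X - x%:P)%:P.
Proof.
elim/poly_ind: p => [|p c IHp]; first by exists 0; rewrite mul0r.
move=> pc0; have: c.[x] = 0.
  have := congr1 (fun u : {poly K} => u`_0) pc0.
  by rewrite coef_map coefD coefMX coefC coef0 eqxx /= add0r.
move/eqP/factor_theorem => [d cE].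
have: map_poly (horner_eval x) p = 0.
  apply/polyP => i; have := congr1 (fun u : {poly K} => u`_i.+1) pc0.
  by rewrite !coef_map coefD coefMX coefC !coef0 /= addr0.
case/IHp => q ->; exists (q * 'X + d%:P).
by rewrite cE mulrDl polyCM mulrAC.
Qed.

(** Gauss's lemma, stripping [c] of one root at a time: at a root [x] of [c], [q * h] vanishes on
    the vertical line through [x] while [h] does not, so [X - x] divides [q]. *)
Lemma gauss_root (c : {poly K}) h q r :
  c != 0 -> (forall x, map_poly (horner_eval x) h != 0) ->
  c%:P * r = q * h -> exists q', r = q' * h.
Proof.
move=> + hprim; have [n] := ubnP (size c); elim: n => // n IHn in c q *.
move=> cn c0 rE; have [c1|] := boolP (size c == 1).
  have /size1_polyC cE : (size c <= 1)%N by rewrite (eqP c1).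
  have c00 : c`_0 != 0 by apply: contraNneq c0; rewrite {2}cE => ->; rewrite polyC0.
  exists ((c`_0)^-1%:P%:P * q); rewrite -mulrA -rE {2}cE mulrA -!polyCM.
  by rewrite mulVf // !polyC1 mul1r.
case/closed_rootP => x /factor_theorem [d dE].
pose f := map_poly (horner_eval x).
have /eqP: f c%:P * f r = f q * f h by rewrite -!rmorphM rE.
have -> : f c%:P = 0 by rewrite /f map_polyC /= dE /horner_eval !hornerE subrr mulr0.
rewrite mul0r eq_sym mulf_eq0 (negPf (hprim x)) orbF => /eqP /map_eval_dvd [q' q'E].
have d0 : d != 0 by apply: contraNneq c0 => d0; rewrite dE d0 mul0r.
apply: (IHn d q') => //.
  by move: cn; rewrite dE size_Mmonic ?monicXsubC // size_XsubC addn2.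
have X0 : ('X - x%:P)%:P != 0 :> {poly {poly K}}.
  by rewrite polyC_eq0 polyXsubC_eq0.
by apply: (mulIf X0); rewrite mulrAC -polyCM -dE rE q'E mulrAC.
Qed.

(* [h] is chosen of minimal degree in the second variable, then of minimal
   leading coefficient, among the polynomials with infinitely many zeros in
   [Z]; pseudo-division by [h] then leaves no remainder. *)
Lemma unlistable_common_factor (Z : K * K -> Prop) : ~ listable Z ->
  exists2 h, ~ is_const h &
    forall r, (forall z, Z z -> ev z r = 0) -> exists q, r = q * h.
Proof.
move=> Zinf; pose I h := h != 0 /\ ~ listable (fun z => Z z /\ ev z h = 0).
have [Iex|Inex] := pselect (exists h, I h); last first.
  (* Here only 0 vanishes on all of [Z], so any nonconstant [h] will do, with quotient 0. *)
  exists 'X => [[c /(congr1 (fun p : {poly {poly K}} => p`_1))]|r rZ].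
    by rewrite coefX coefC => /eqP; rewrite oner_eq0.
  exists 0; rewrite mul0r; apply/eqP; apply: contra_notT Inex => r0.
  by exists r; split=> //; apply: contra_not Zinf; apply: listable_sub => z Zz; split; auto.
have [h0 I0 h0min] := exists_minimal (fun h => size h) Iex.
have [|h [Ih sh] hmin] := @exists_minimal _ (fun h => I h /\ size h = size h0)
   (fun h => size (lead_coef h)); first by exists h0.
have smin g : I g -> (size h <= size g)%N by rewrite sh; apply: h0min.
have {}hmin g : I g -> size g = size h -> (size (lead_coef h) <= size (lead_coef g))%N.
  by move=> Ig sg; apply: hmin; rewrite sg.
have {sh h0 I0 h0min} [h0 hZ] := Ih.
have IM p q : I (p * q) -> I p \/ I q.
  move=> [pq0 pqZ]; move: (pq0); rewrite mulf_eq0 negb_or => /andP[p0 q0].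
  have [|Ip] := pselect (I p); first by left.
  right; split=> // Iq; apply: pqZ.
  apply: listable_sub (listableU (Y := fun z => Z z /\ ev z p = 0) _ Iq).
    move=> z [Zz /eqP]; rewrite evM mulf_eq0 => /orP[] /eqP ?; by [left|right].
  by apply: contra_notP Ip.
have Iline x : I ('X - x%:P)%:P ->
    forall r, (forall z, Z z -> ev z r = 0) -> exists q, r = q * ('X - x%:P)%:P.
  move=> [_ lZ] r rZ; apply: map_eval_dvd; apply/eqP; apply: contra_notT lZ => rx.
  have [t tE] := closed_field_poly_normal (map_poly (horner_eval x) r).
  exists (map (pair x) t) => -[x' y] [/rZ]; rewrite evC !hornerE /=.
  move=> rxy /eqP; rewrite subr_eq0 => /eqP xx'; move: rxy; rewrite {}xx' ev_row.
  move=> /eqP; rewrite tE hornerZ mulf_eq0 lead_coef_eq0 (negPf rx) /=.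
  by rewrite -[_ == 0]/(root _ y) root_prod_XsubC => yt; apply/map_f.
have Iconst p : I p -> ~ is_const p.
  move=> [p0 pZ]; have [z [_ pz] _] := unlistable_notin [::] pZ.
  exact: neq0_zero_nonconst p0 pz.
have [[x Ix]|Inx] := pselect (exists x, I ('X - x%:P)%:P).
  by exists ('X - x%:P)%:P; [exact: Iconst|exact: Iline].
(* A vertical line dividing [h] could be cancelled: the quotient has the same degree in the second
   variable and a smaller leading coefficient, against minimality. *)
have hprim x : map_poly (horner_eval x) h != 0.
  apply/eqP => /map_eval_dvd [q hE].
  have [|Iq|Ix] := IM q ('X - x%:P)%:P; [by rewrite -hE| |by case: Inx; exists x].
  have X0 : 'X - x%:P != 0 by rewrite polyXsubC_eq0.
  have sq : size q = size h by rewrite hE mulrC size_Cmul.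
  have := hmin q Iq sq; rewrite hE lead_coefM lead_coefC.
  rewrite size_Mmonic ?monicXsubC ?size_XsubC ?addn2 ?ltnn //.
  by rewrite lead_coef_eq0; case: Iq.
exists h => [|r rZ]; first exact: Iconst.
pose c := lead_coef h ^+ Pdiv.IdomainDefs.scalp r h.
have rE : c%:P * r = Pdiv.IdomainDefs.divp r h * h + Pdiv.IdomainDefs.modp r h.
  by rewrite mul_polyC Pdiv.Idomain.divp_eq.
apply: (@gauss_root c h (Pdiv.IdomainDefs.divp r h)) => //.
  by rewrite expf_neq0 // lead_coef_eq0.
rewrite rE; set s := Pdiv.IdomainDefs.modp r h.
suff -> : s = 0 by rewrite addr0.
(* A nonzero remainder would vanish at the infinitely many zeros of [h] in [Z] and have smaller
   degree than [h]. *)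
apply/eqP/negPn/negP => s0.
have := Pdiv.Idomain.ltn_modp r h; rewrite h0 ltnNge smin //; split=> //.
apply: contra_not hZ; apply: listable_sub => z [Zz hz]; split=> //.
have := congr1 (ev z) rE; rewrite evD !evM rZ // hz !mulr0 add0r.
by move=> <-.
Qed.

Definition planar (P Q : {poly {poly K}}) w : K * K := (ev w P, ev w Q).

Lemma ev_comp (P Q h : {poly {poly K}}) :
  exists k, forall w, ev w k = ev (planar P Q w) h.
Proof.
have comp1 (c : {poly K}) : exists k, forall z, ev z k = c.[ev z P].
  elim/poly_ind: c => [|c a [k kE]]; first by exists 0 => z; rewrite rmorph0 horner0.
  by exists (k * P + a%:P%:P) => z; rewrite !ev_simp kE hornerMXaddC.
elim/poly_ind: h => [|h c [k kE]]; first by exists 0 => z; rewrite !rmorph0.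
have [d dE] := comp1 c.
by exists (k * Q + d) => z; rewrite !ev_simp kE dE.
Qed.

(** * Elimination of one variable *)

Lemma resultant_eq0_root (p q : {poly K}) : p != 0 ->
  reflect (exists2 y, root p y & root q y) (resultant p q == 0).
Proof.
move=> p0; rewrite resultant_eq0; apply: (iffP idP) => [g1|[y py qy]].
  have: size (gcdp p q) != 1 by rewrite neq_ltn g1 orbT.
  by case/closed_rootP => y; rewrite root_gcd => /andP[]; exists y.
rewrite ltnNge; apply/negP => g1.
have gy : root (gcdp p q) y by rewrite root_gcd py qy.
have g0 : gcdp p q != 0 by rewrite gcdp_eq0 negb_and p0.
by move: gy; rewrite (size1_polyC g1) rootC -polyC_eq0 -(size1_polyC g1) (negPf g0).
Qed.

(** When both leading coefficients survive [e], the resultant commutes with specialization and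
    detects a common root. *)
Lemma specialized_resultant_eq0 (D : idomainType) (e : {rmorphism {poly D} -> K})
    (A B : {poly {poly D}}) : e (lead_coef A) != 0 -> e (lead_coef B) != 0 ->
  reflect (exists2 y, root (map_poly e A) y & root (map_poly e B) y)
          (e (resultant A B) == 0).
Proof.
move=> eA eB; rewrite map_resultant //; apply: resultant_eq0_root.
by rewrite -lead_coef_eq0 lead_coef_map_eq.
Qed.

(* [Y^M (P - z.1)] is added to [Q - z.2] so that both arguments of the resultant
   have constant leading coefficients and specialization keeps their degrees. *)
Lemma elimination (P Q : {poly {poly K}}) (c : K) :
    c != 0 -> lead_coef P = c%:P -> (1 < size P)%N ->
  exists R : {poly {poly {poly K}}}, forall z x,
    root (map_poly (ev z) R) x <->
    exists2 y, ev (x, y) P = z.1 & ev (x, y) Q = z.2.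
Proof.
move=> c0 lP sP.
(* [lift] reads a polynomial in the first source variable over the ring of polynomials in the target
   coordinates. The terms subtracted in [A] and [B] are these two coordinates; the outermost
   variable is the one to eliminate. *)
pose lift : {poly K} -> {poly {poly {poly K}}} := map_poly (polyC \o polyC).
have lift_inj : injective lift.
  by apply: map_inj_poly => [x y /= /polyC_inj /polyC_inj|//].
pose A := map_poly lift P - ('X%:P%:P)%:P.
pose B := map_poly lift Q - ('X%:P)%:P + A * 'X^(size Q).
have slift p : size (map_poly lift p) = size p.
  by rewrite size_map_inj_poly // /lift rmorph0.
have sC (u : {poly {poly {poly K}}}) n : (1 < n)%N -> (size (- u%:P) < n)%N.
  by move=> n1; rewrite size_polyN (leq_ltn_trans (size_polyC_leq1 _)).
have sA : size A = size P by rewrite size_polyDl ?slift // sC.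
have lA : lead_coef A = c%:P%:P%:P.
  rewrite lead_coefDl ?slift ?sC // lead_coef_map_inj ?/lift ?rmorph0 //.
  by rewrite lP map_polyC.
have lB : lead_coef B = c%:P%:P%:P.
  have A0 : A != 0 by rewrite -size_poly_gt0 sA ltnW.
  rewrite lead_coefDr ?lead_coefM ?lead_coefXn ?mulr1 //.
  rewrite size_mulXn // sA (leq_ltn_trans (size_polyD _ _)) // gtn_max slift.
  rewrite -[X in (X < _)%N]addn0 ltn_add2l (ltnW sP) sC //.
  by rewrite (leq_trans sP) // leq_addl.
exists (resultant A B) => z x.
(* [e] sends the target coordinates to [z] and the first source variable to [x]. *)
pose e : {rmorphism {poly {poly {poly K}}} -> K} := horner_eval x \o map_poly (ev z).
have e_lift p : map_poly e (map_poly lift p) = map_poly (horner_eval x) p.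
  rewrite -map_poly_comp; apply: eq_map_poly => u /=.
  rewrite /e /lift /= -map_poly_comp map_poly_id // => a _ /=.
  by rewrite !ev_simp.
have eA : map_poly e A = map_poly (horner_eval x) P - z.1%:P.
  rewrite rmorphB /= e_lift map_polyC /= map_polyC /= /horner_eval hornerC.
  by rewrite !ev_simp.
have eB : map_poly e B = map_poly (horner_eval x) Q - z.2%:P + map_poly e A * 'X^(size Q).
  rewrite rmorphD rmorphM rmorphB /= e_lift map_polyXn map_polyC /= map_polyC /=.
  by rewrite /horner_eval hornerC !ev_simp.
have ec : e c%:P%:P%:P = c by rewrite /e /= map_polyC /= /horner_eval hornerC !ev_simp.
have elA : e (lead_coef A) != 0 by rewrite lA ec.
have elB : e (lead_coef B) != 0 by rewrite lB ec.
have -> : root (map_poly (ev z) (resultant A B)) x = (e (resultant A B) == 0) by [].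
have rootA y : root (map_poly e A) y = (ev (x, y) P == z.1).
  by rewrite rootE eA !hornerE -ev_row subr_eq0.
have rootB y : root (map_poly e A) y -> root (map_poly e B) y = (ev (x, y) Q == z.2).
  by move=> /rootP Ay; rewrite rootE eB !hornerE Ay mul0r addr0 -ev_row subr_eq0.
split.
  case/(specialized_resultant_eq0 elA elB) => y Ay; rewrite rootB // => /eqP Qy.
  by exists y => //; apply/eqP; rewrite -rootA.
case=> y /eqP; rewrite -rootA => Ay /eqP Qy.
by apply/(specialized_resultant_eq0 elA elB); exists y; rewrite ?rootB.
Qed.

(** * The image and the first coordinate, read off the eliminant *)

Definition finite_fibers P Q := forall z, listable (fun w => planar P Q w = z).

Definition eliminant P Q R := forall z x,
  root (map_poly (ev z) R) x <-> exists y, planar P Q (x, y) = z.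

Lemma eliminant_exists P Q (c : K) :
    c != 0 -> lead_coef P = c%:P -> (1 < size P)%N ->
  exists R, eliminant P Q R.
Proof.
move=> c0 lP sP; have [R RP] := elimination Q c0 lP sP.
exists R => -[a b] x; rewrite RP; split=> [[y Py Qy]|[y [Py Qy]]]; exists y => //.
by rewrite /planar Py Qy.
Qed.

Definition multiple_value P Q z :=
  exists w w', [/\ w != w', planar P Q w = z & planar P Q w' = z].

(** Such a [p] is a multiple of a power of [X - x]; this is Vieta's formula for the sum of the
    roots. *)
Lemma single_root_coef (p : {poly K}) x : (1 < size p)%N ->
    (forall y, root p y -> y = x) ->
  p`_(size p).-2 = - ((size p).-1%:R * x * lead_coef p).
Proof.
move=> s1 px; have p0 : p != 0 by rewrite -size_poly_gt0 ltnW.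
have [t tE] := closed_field_poly_normal p.
have tx : t = nseq (size t) x.
  apply/all_pred1P/allP => y yt /=; apply/eqP/px.
  by rewrite tE rootZ ?lead_coef_eq0 // root_prod_XsubC.
have st : size p = (size t).+1.
  by rewrite {1}tE size_scale ?lead_coef_eq0 // size_prod_XsubC.
have t0 : size t != 0 by move: s1; rewrite st; case: (size t).
rewrite {1}tE coefZ st /= (coefPn_prod_XsubC t0) tx big_nseq size_nseq.
by rewrite iter_addr_0 mulrN mulrC mulr_natl.
Qed.

Section Eliminant.
Variables (P Q : {poly {poly K}}) (R : {poly {poly {poly K}}}).
Hypotheses (finF : finite_fibers P Q) (elimR : eliminant P Q R).

(** A zero specialization would put a point of the fibre over every abscissa, against finiteness. *)
Lemma eliminant_neq0 z : map_poly (ev z) R != 0.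
Proof.
apply/eqP => R0; have [s sP] := finF z.
have [x xs _] := nonroot_notin (map fst s) (oner_neq0 {poly K}).
have /(elimR z x) [y Fz]: root (map_poly (ev z) R) x by rewrite R0 root0.
by case/mapP: xs; exists (x, y); first exact: sP.
Qed.

Lemma eliminant_size : (1 < size R)%N.
Proof.
rewrite ltnNge; apply/negP => /size1_polyC RE.
have r : root (map_poly (ev (planar P Q 0)) R) 0 by apply/elimR; exists 0.
have := eliminant_neq0 (planar P Q 0); move: r.
by rewrite RE map_polyC rootC polyC_eq0 => ->.
Qed.

Lemma eliminant_lead_neq0 : lead_coef R != 0.
Proof. by rewrite lead_coef_eq0 -size_poly_gt0 ltnW ?eliminant_size. Qed.

(** The specialized eliminant is nonzero, so over an algebraically closed field it has a root
    exactly when its degree is positive. *)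
Lemma image_eliminant z :
  (exists w, planar P Q w = z) <-> exists2 i, (0 < i)%N & ev z R`_i != 0.
Proof.
split=> [[[x y] Fz]|[i i0 Ri]].
  have Rx : root (map_poly (ev z) R) x by apply/elimR; exists y.
  have s1 : (1 < size (map_poly (ev z) R))%N.
    by rewrite (root_size_gt1 _ Rx) ?eliminant_neq0.
  exists (size (map_poly (ev z) R)).-1; first by rewrite -subn1 subn_gt0.
  by rewrite -coef_map -lead_coefE lead_coef_eq0 eliminant_neq0.
have: size (map_poly (ev z) R) != 1.
  apply: contra Ri => /eqP s1; rewrite -coef_map; apply/eqP/nth_default.
  by rewrite s1.
by case/closed_rootP => x /elimR [y Fz]; exists (x, y).
Qed.

Lemma image_lead z : ev z (lead_coef R) != 0 -> exists w, planar P Q w = z.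
Proof.
move=> lz; apply/image_eliminant; exists (size R).-1 => //.
by rewrite -subn1 subn_gt0 eliminant_size.
Qed.

(** The map is dominant: its image contains the dense set where the leading coefficient of [R] does
    not vanish. *)
Lemma planar_ev_eq0 p : (forall w, ev (planar P Q w) p = 0) -> p = 0.
Proof.
move=> p0; apply: (ev_eq0_dense eliminant_lead_neq0) => z /image_lead [w <-].
exact: p0.
Qed.

(* The missing points are the common zeros of the coefficients of positive
   degree of [R]; a common factor [g] of these has no zero on the image, so it
   pulls back to a constant. *)
Lemma coimage_listable : listable (fun z => ~ exists w, planar P Q w = z).
Proof.
have [//|/unlistable_common_factor [g gc gdvd]] :=
  pselect (listable (fun z => ~ exists w, planar P Q w = z)).
have gF w : ev (planar P Q w) g != 0.
  have [i i0] := (image_eliminant (planar P Q w)).1 (ex_intro _ w erefl).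
  apply: contra => /eqP gz; have [|q ->] := gdvd R`_i.
    move=> z nz; apply/eqP; apply: contra_notT nz => Riz.
    by apply/image_eliminant; exists i.
  by rewrite evM gz mulr0.
have [k kE] := ev_comp P Q g.
have [[c kc]|knc] := pselect (is_const k); last first.
  have [w kw _] := nonconst_zeros [::] knc.
  by have := gF w; rewrite -kE kw eqxx.
case: gc; exists c; apply/eqP; rewrite -subr_eq0; apply/eqP.
apply: planar_ev_eq0 => w.
by rewrite evB -kE kc !ev_simp subrr.
Qed.

(* Where [F w] has no other preimage, [w.1] is the only root of the eliminant,
   so the two leading coefficients of the latter determine it. *)
Lemma coord_rational : listable (multiple_value P Q) ->
  exists2 v, v != 0 & exists u, forall w,
    ev (planar P Q w) u = w.1 * ev (planar P Q w) v.
Proof.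
case/listable_ev_neq0 => e e0 eE; set r := lead_coef R.
have r0 : r != 0 := eliminant_lead_neq0.
have R1 := eliminant_size.
pose n : {poly {poly K}} := (size R).-1%:R.
have nE z : ev z n = (size R).-1%:R by rewrite /n rmorph_nat.
have n0 : n != 0.
  apply/eqP => nz; have := nE 0; rewrite nz rmorph0 => /eqP.
  by rewrite eq_sym pnatr_eq0 -subn1 subn_eq0 leqNgt R1.
(* Over a value taken once, at [w], Vieta's formula gives [- n * w.1 * r] for the second
   coefficient. The degree [n] is nonzero in characteristic 0. *)
exists (- n * r); first by rewrite mulf_neq0 ?oppr_eq0.
exists R`_(size R).-2.
have [u uE] := ev_comp P Q R`_(size R).-2; have [v vE] := ev_comp P Q (n * r).
have [k kE] := ev_comp P Q (r * e).
suff: u + 'X%:P * v = 0.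
  move=> uv0 w; have := congr1 (ev w) uv0.
  rewrite !ev_simp uE vE !ev_simp => /eqP; rewrite addr_eq0 => /eqP ->.
  by rewrite mulNr mulrN.
apply: (@ev_eq0_dense _ k).
  have [z zre] : exists z, ev z (r * e) != 0 by apply: ev_neq0; rewrite mulf_neq0.
  have [w wz] : exists w, planar P Q w = z.
    by apply: image_lead; apply: contra zre; rewrite evM mulf_eq0 => ->.
  apply: contraNneq zre => k0; have := kE w; rewrite k0 rmorph0 => kw.
  by rewrite -wz -kw.
move=> w; rewrite kE evM mulf_eq0 negb_or => /andP[rw ew].
rewrite !ev_simp uE vE !ev_simp nE.
have sR : size (map_poly (ev (planar P Q w)) R) = size R by rewrite size_poly_eq.
have := @single_root_coef (map_poly (ev (planar P Q w)) R) w.1.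
rewrite sR coef_map lead_coef_map_eq // => -> //; first last.
  move=> x /elimR [y Fxy]; apply/eqP; apply: contraNT ew => xw.
  rewrite eE //; exists (x, y), w; split=> //.
  by apply: contra xw => /eqP <-.
by rewrite mulrCA mulrA addNr.
Qed.

(* In a fraction [u / v] with [v] of minimal size, [v] and [u] have no common
   factor, yet they vanish together at the zeros of [v] lying in the image. *)
Lemma coord_polynomial : listable (multiple_value P Q) ->
  exists G, forall w, ev (planar P Q w) G = w.1.
Proof.
move=> /coord_rational [v0 v00 [u0 uv0]].
pose I v := v != 0 /\ exists u, forall w,
  ev (planar P Q w) u = w.1 * ev (planar P Q w) v.
(* This measure drops strictly when a nonconstant factor is cancelled, whichever variable the factor
   involves. *)
have [v [v_neq0 [u uv]] vmin] := @exists_minimal _ I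
  (fun v => size v + size (lead_coef v))%N (ex_intro _ v0 (conj v00 (ex_intro _ u0 uv0))).
have [[c vc]|vnc] := pselect (is_const v).
  have c0 : c != 0 by move: v_neq0; rewrite vc !polyC_eq0.
  exists (c^-1%:P%:P * u) => w.
  by rewrite evM uv vc !ev_simp mulrCA mulVf ?mulr1.
(* A nonconstant [v] has infinitely many zeros, and only finitely many of them lie off the image. *)
have Zinf : ~ listable (fun z => ev z v = 0 /\ exists w, planar P Q w = z).
  move=> [s sZ]; have [t tS] := coimage_listable.
  have [z vz] := nonconst_zeros (s ++ t) vnc.
  rewrite mem_cat; have [zF|/tS ->] := pselect (exists w, planar P Q w = z).
    by rewrite sZ.
  by rewrite orbT.
have [h hnc hdvd] := unlistable_common_factor Zinf.
have [v' vE] : exists q, v = q * h by apply: hdvd => z [].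
have [u' uE] : exists q, u = q * h.
  by apply: hdvd => z [vz [w wz]]; rewrite -wz uv wz vz mulr0.
have h0 := nonconst_neq0 hnc.
have v'0 : v' != 0 by apply: contraNneq v_neq0 => v'0; rewrite vE v'0 mul0r.
have Iv' : I v'.
  split=> //; exists u' => w.
  have [k1 k1E] := ev_comp P Q u'; have [k2 k2E] := ev_comp P Q v'.
  have [k kE] := ev_comp P Q h.
  rewrite -k1E -k2E; apply/eqP; rewrite -subr_eq0.
  suff k12 : k1 - 'X%:P * k2 = 0.
    by have := congr1 (ev w) k12; rewrite !ev_simp => ->.
  (* Cancellation of the pullback [k] of [h], which is nonzero because the map is dominant. *)
  apply: (@ev_eq0_dense _ k) => [|t kw].
    apply: contraNneq h0 => k0; apply/eqP/planar_ev_eq0 => t.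
    by rewrite -kE k0 rmorph0.
  apply: (mulIf kw); rewrite mul0r !ev_simp k1E k2E kE.
  by rewrite mulrBl -mulrA -!evM -uE -vE uv subrr.
have := vmin v' Iv'; rewrite leqNgt => /negP[].
have lh0 : lead_coef h != 0 by rewrite lead_coef_eq0.
have lv'0 : lead_coef v' != 0 by rewrite lead_coef_eq0.
rewrite vE lead_coefM !size_mul //.
move: h0 lh0; rewrite -!size_poly_gt0.
have: (1 < size h)%N || (1 < size (lead_coef h))%N.
  rewrite -[_ || _]negbK negb_or -!leqNgt; apply/negP => /andP[/size1_polyC hE].
  rewrite {1}hE lead_coefC => /size1_polyC h1; apply: hnc.
  by exists (h`_0`_0); rewrite -h1.
move: (size v') (size h) (size (lead_coef v')) (size (lead_coef h)) => a b c d.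
lia.
Qed.
End Eliminant.

(** * Polynomial maps with finite fibres *)

Lemma coef_linear_exp (T : comNzRingType) (a b : T) i n : (i <= n)%N ->
  ((a%:P + b%:P * 'X) ^+ i)`_n = b ^+ i *+ (i == n).
Proof.
elim: i n => [|i IHi] [|n] // le_in.
- by rewrite coef1.
- by rewrite coef1.
rewrite exprSr mulrDr mulrA coefD coefMX !coefMC /= (IHi n.+1 (ltnW le_in)) (IHi n le_in).
by rewrite ltn_eqF ?ltnS // mul0r add0r mulrnAl -exprSr eqSS.
Qed.

Lemma ev_coef_wide p n : (forall i j, (n <= i + j)%N -> p`_j`_i = 0) ->
  forall z, ev z p = \sum_(j < n) (\sum_(i < n) p`_j`_i * z.1 ^+ i) * z.2 ^+ j.
Proof.
move=> pn z; have sp : (size p <= n)%N.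
  apply/leq_sizeP => j nj; apply/polyP => i; rewrite coef0 pn //.
  by rewrite (leq_trans nj) ?leq_addl.
rewrite evE (horner_coef_wide _ sp) -[_.[z.1]]/(horner_eval z.1 _) rmorph_sum.
apply: eq_bigr => j _; rewrite /= /horner_eval hornerM -polyC_exp hornerC.
rewrite (@horner_coef_wide _ n) //; apply/leq_sizeP => i ni.
by rewrite pn // (leq_trans ni) ?leq_addr.
Qed.

(* The leading coefficient of the sheared polynomial is the value at [(t, 1)] of the
   homogeneous part of highest degree. *)
Lemma shear_const_lead P : ~ is_const P ->
  exists2 d : {poly K}, d != 0 & forall t, d.[t] != 0 -> exists P',
    [/\ forall z, ev z P' = ev (z.1 + t * z.2, z.2) P,
        lead_coef P' = d.[t]%:P & (1 < size P')%N].
Proof.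
move=> Pc.
(* [I n] bounds the total degree strictly by [n]; after the case analysis on the least bound, [n] is
   the total degree of [P]. *)
pose I n := forall i j, (n <= i + j)%N -> P`_j`_i = 0.
have Iex : exists n, I n.
  exists (size P + \max_(j < size P) size (P`_j)%R)%N => i j ij.
  have [Pj|jP] := leqP (size P) j; first by rewrite (nth_default _ Pj) coef0.
  rewrite nth_default //.
  apply: leq_trans (@leq_bigmax _ (fun j : 'I_(size P) => size P`_j) (Ordinal jP)) _.
  by move: ij; set m := (\max_(_ < _) _)%N; move: (size P) jP m => k jk m; lia.
have [n In nmin] := exists_minimal id Iex.
case: n => [|n] in In nmin.
  by case: Pc; exists 0; apply/polyP => j; apply/polyP => i; rewrite In // !coef0.
have n0 : (0 < n)%N.
  rewrite lt0n; apply/eqP => nz; apply: Pc; exists P`_0`_0.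
  apply/polyP => j; apply/polyP => i; rewrite !coefC.
  case: j => [|j] /=; last by rewrite coef0 In //; lia.
  by case: i => [|i]; rewrite coefC //= In //; lia.
have [i0 [j0 [ijn Pij]]] : exists i j, (i + j)%N = n /\ P`_j`_i != 0.
  have [//|nij] := pselect (exists i j, (i + j)%N = n /\ P`_j`_i != 0).
  have /nmin : I n; last by rewrite ltnn.
  move=> i j; rewrite leq_eqVlt => /predU1P[nE|/In //].
  by apply/eqP; apply: contra_notT nij => Pij; exists i, j.
pose d := \poly_(i < n.+1) P`_(n - i)`_i.
exists d => [|t dt].
  have : d`_i0 != 0 by rewrite coef_poly -ijn ltnS leq_addr addKn.
  by apply: contraNneq => ->; rewrite coef0.
pose L : {poly {poly K}} := 'X%:P + t%:P%:P * 'X.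
pose P' := \sum_(j < n.+1) (\sum_(i < n.+1) (P`_j`_i)%:P%:P * L ^+ i) * 'X^j.
have evP' z : ev z P' = ev (z.1 + t * z.2, z.2) P.
  rewrite (ev_coef_wide In) rmorph_sum; apply: eq_bigr => j _ /=.
  rewrite evM rmorphXn /= evX rmorph_sum; congr (_ * _).
  apply: eq_bigr => i _ /=; rewrite evM !evC hornerC rmorphXn /=; congr (_ * _ ^+ _).
  by rewrite /L !ev_simp.
have coefP' m : (n <= m)%N ->
    P'`_m = (\sum_(j < n.+1) \sum_(i < n.+1) P`_j`_i * t ^+ i *+ (i + j == m)%N)%:P.
  move=> nm; rewrite coef_sum rmorph_sum; apply: eq_bigr => j _ /=.
  have jm : (j <= m)%N by have := ltn_ord j; lia.
  rewrite coefMXn ltnNge jm /= coef_sum rmorph_sum; apply: eq_bigr => i _ /=.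
  rewrite coefCM; have [ijm|mij] := leqP (i + j) m; last first.
    by rewrite In ?mul0r ?mul0rn ?polyC0 ?mul0r //; lia.
  rewrite coef_linear_exp; last by lia.
  have -> : (i == m - j :> nat)%N = (i + j == m)%N by lia.
  by rewrite mulrnAr -polyC_exp -polyCM rmorphMn.
have P'n : P'`_n = d.[t]%:P.
  rewrite coefP' // horner_poly exchange_big; congr (_%:P); apply: eq_bigr => i _ /=.
  rewrite (bigD1 (rev_ord i)) //= big1 => [|j].
    by rewrite addr0 subSS subnKC ?eqxx // -ltnS.
  rewrite -val_eqE /= => ji.
  have -> : (i + j == n)%N = false; last by rewrite mulr0n.
  by have := ltn_ord i; have := ltn_ord j; lia.
have sP' : size P' = n.+1.
  apply/eqP; rewrite eqn_leq; apply/andP; split.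
    apply/leq_sizeP => m nm; rewrite coefP' ?(ltnW nm) // big1 // => j _.
    rewrite big1 // => i _; have [ijm|_] := eqP; last by rewrite mulr0n.
    by rewrite In ?mul0r ?mul0rn // ijm.
  rewrite ltnNge; apply: contra dt => /leq_sizeP/(_ n (leqnn n)).
  by rewrite P'n => /eqP; rewrite polyC_eq0.
by exists P'; rewrite lead_coefE sP' P'n.
Qed.

Definition shear (t : K) z : K * K := (z.1 + t * z.2, z.2).

Lemma shearK t : cancel (shear t) (shear (- t)).
Proof. by case=> x y; rewrite /shear /= mulNr addrK. Qed.

Lemma shearNK t : cancel (shear (- t)) (shear t).
Proof. by move=> z; rewrite -{1}(opprK t) shearK. Qed.

(** With [P] constant, the fibre through the origin is the zero set of [r], a curve or the whole
    plane. *)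
Lemma finite_fibers_nonconst P Q : finite_fibers P Q -> ~ is_const P.
Proof.
move=> finF [c Pc]; pose r := Q - (ev 0 Q)%:P%:P.
have [s sF] := finF (c, ev 0 Q).
have sr z : ev z r = 0 -> z \in s.
  move=> rz; apply: sF; rewrite /planar Pc !ev_simp; congr (_, _).
  by apply/eqP; rewrite -subr_eq0 -rz !ev_simp.
have [[a ra]|/(nonconst_zeros s) [z /sr -> //]] := pselect (is_const r).
have Xnc : ~ is_const ('X : {poly {poly K}}).
  move=> [b /(congr1 (fun p : {poly {poly K}} => p`_1))].
  by rewrite coefX coefC => /eqP; rewrite oner_eq0.
have [z _] := nonconst_zeros s Xnc; rewrite sr //.
have : ev 0 r = 0 by rewrite /r !ev_simp subrr.
by rewrite ra !ev_simp.
Qed.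

(** For [t] off the roots of [d], the shear makes the leading coefficient in the second variable
    constant, as elimination requires. *)
Lemma sheared_eliminant P Q : finite_fibers P Q ->
  exists2 d : {poly K}, d != 0 & forall t, d.[t] != 0 -> exists P' Q' R,
    [/\ forall z, planar P' Q' z = planar P Q (shear t z),
        finite_fibers P' Q' & eliminant P' Q' R].
Proof.
move=> finF; have [d d0 dP] := shear_const_lead (finite_fibers_nonconst finF).
exists d => // t dt; have [P' [P'E lP' sP']] := dP t dt.
have [Q' Q'E] := ev_comp ('X%:P + t%:P%:P * 'X) 'X Q.
have [R elimR] := eliminant_exists Q' dt lP' sP'.
have F'E z : planar P' Q' z = planar P Q (shear t z).
  by rewrite /planar P'E Q'E /planar !ev_simp.
exists P', Q', R; split=> // z; have [s sF] := finF z.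
exists (map (shear (- t)) s) => w; rewrite F'E => /sF ws.
by apply/mapP; exists (shear t w) => //; rewrite shearK.
Qed.

Lemma finite_fibers_coimage P Q : finite_fibers P Q ->
  listable (fun z => ~ exists w, planar P Q w = z).
Proof.
case/sheared_eliminant => d /closed_nonrootP [t dt] dP.
have [P' [Q' [R [F'E finF' elimR]]]] := dP t dt.
apply: listable_sub (coimage_listable finF' elimR) => z; apply: contra_not.
by case=> w <-; exists (shear t w); rewrite F'E.
Qed.

(** Each admissible shear makes [w.1 - t * w.2] a polynomial in the image of [w]; two distinct
    values of [t] determine both coordinates. *)
Lemma finite_fibers_left_inverse P Q :
    finite_fibers P Q -> listable (multiple_value P Q) ->
  exists G1 G2, forall w, planar G1 G2 (planar P Q w) = w.
Proof.
move=> finF mulF; have [d d0 dP] := sheared_eliminant finF.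
have coordF t : d.[t] != 0 -> exists G, forall w, ev (planar P Q w) G = w.1 - t * w.2.
  move=> dt; have [P' [Q' [R [F'E finF' elimR]]]] := dP t dt.
  have [|G GE] := coord_polynomial finF' elimR.
    apply: listable_sub mulF => z [w [w' [ww' wz w'z]]].
    exists (shear t w), (shear t w'); split; rewrite -?F'E //.
    by rewrite (can_eq (shearK t)).
  exists G => w; have := GE (shear (- t) w); rewrite F'E shearNK => ->.
  by rewrite /shear /= mulNr.
have [t1 _ /coordF [G1 G1E]] := nonroot_notin [::] d0.
have [t2] := nonroot_notin [:: t1] d0.
rewrite inE -subr_eq0 => t12 /coordF [G2 G2E].
have [G GE] : exists G, forall w, ev (planar P Q w) G = w.2.
  exists ((t2 - t1)^-1%:P%:P * (G1 - G2)) => w.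
  by rewrite !ev_simp G1E G2E; field.
exists (G1 + t1%:P%:P * G), G => w.
have G1E' : ev (planar P Q w) (G1 + t1%:P%:P * G) = w.1.
  by rewrite !ev_simp GE G1E subrK.
by apply: etrans (congr2 pair G1E' (GE w)) _; case: w {G1E'}.
Qed.

(** A left inverse is also a right inverse on the image, which is cofinite, hence dense; the
    polynomial identity then holds everywhere. *)
Lemma finite_fibers_inverse P Q :
    finite_fibers P Q -> listable (multiple_value P Q) ->
  exists G1 G2, cancel (planar P Q) (planar G1 G2) /\ cancel (planar G1 G2) (planar P Q).
Proof.
move=> finF mulF; have [G1 [G2 GK]] := finite_fibers_left_inverse finF mulF.
exists G1, G2; split=> //.
have [e e0 eS] := listable_ev_neq0 (finite_fibers_coimage finF).
have onimage z : ev z e != 0 -> planar P Q (planar G1 G2 z) = z.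
  move=> ez; have [[w <-]|nz] := pselect (exists w, planar P Q w = z).
    by rewrite GK.
  by rewrite eS ?eqxx in ez.
have [P' P'E] := ev_comp G1 G2 P; have [Q' Q'E] := ev_comp G1 G2 Q.
move=> z; transitivity (planar P' Q' z); first by rewrite [RHS]/planar P'E Q'E.
have -> : P' = 'X%:P.
  apply/eqP; rewrite -subr_eq0; apply/eqP/(ev_eq0_dense e0) => {}z ez.
  by rewrite !ev_simp P'E -{2}(onimage z ez) subrr.
have -> : Q' = 'X.
  apply/eqP; rewrite -subr_eq0; apply/eqP/(ev_eq0_dense e0) => {}z ez.
  by rewrite !ev_simp Q'E -{2}(onimage z ez) subrr.
by rewrite /planar !ev_simp; case: z.
Qed.

End Plane.

(** * Maps with constant Jacobian *)

Notation ord1 := (@Ordinal 2 1 isT).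

Lemma det_mx22 (T : comNzRingType) (M : 'M[T]_2) :
  \det M = M ord0 ord0 * M ord1 ord1 - M ord0 ord1 * M ord1 ord0.
Proof.
rewrite (expand_det_row _ ord0) 2!big_ord_recl big_ord0 addr0.
rewrite /cofactor !det_mx11 !mxE /= expr0 expr1 mul1r mulN1r mulrN.
by congr (_ * M _ _ - M _ _ * M _ _); apply: val_inj.
Qed.

Lemma mpoly_ring_ind (n : nat) (T : nzRingType) (S : {mpoly T[n]} -> Prop) :
    (forall c, S c%:MP) -> (forall i, S 'X_i) ->
    (forall p q, S p -> S q -> S (p + q)) -> (forall p q, S p -> S q -> S (p * q)) ->
  forall p, S p.
Proof.
move=> SC SX SD SM; have S1 : S 1 by rewrite -mpolyC1.
elim/mpolyind => [|c m p _ _ Sp]; first by rewrite -mpolyC0.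
apply: SD => //; rewrite -mul_mpolyC mpolyXE_id; apply: (SM _ _ (SC c)).
elim/big_ind: _ => // i _; elim: (m i) => [|k IHk]; first by rewrite expr0.
by rewrite exprS; apply: SM.
Qed.

Lemma mderivXU (n : nat) (T : nzRingType) (i j : 'I_n) :
  mderiv j ('X_i : {mpoly T[n]}) = (i == j)%:R.
Proof.
rewrite mderivX mnmE; case: eqVneq => [->|_]; last by rewrite scale0r.
rewrite scale1r; have -> : (U_(j) - U_(j) = 0 :> 'X_{1.. n})%MM; last exact: mpolyX0.
by apply/mnmP => k; rewrite mnmBE subnn mnm0E.
Qed.

Lemma mderiv_comp (n k : nat) (T : comNzRingType) (lq : n.-tuple {mpoly T[k]})
    (j : 'I_k) (p : {mpoly T[n]}) :
  mderiv j (p \mPo lq) = \sum_(i < n) (mderiv i p \mPo lq) * mderiv j (tnth lq i).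
Proof.
elim/mpoly_ring_ind: p => [c|i|p q IHp IHq|p q IHp IHq].
- rewrite comp_mpolyC mderivC big1 // => i _.
  by rewrite mderivC comp_mpoly0 mul0r.
- rewrite comp_mpolyXU -tnth_nth (bigD1 i) //= big1 => [|l li].
    by rewrite mderivXU eqxx comp_mpoly1 mul1r addr0.
  by rewrite mderivXU eq_sym (negPf li) comp_mpoly0 mul0r.
- rewrite comp_mpolyD mderivD IHp IHq -big_split; apply: eq_bigr => i _ /=.
  by rewrite mderivD comp_mpolyD mulrDl.
- rewrite rmorphM mderivM IHp IHq mulr_suml mulr_sumr -big_split.
  apply: eq_bigr => i _ /=.
  rewrite mderivM rmorphD !rmorphM /= mulrDl; congr (_ + _); last by rewrite mulrA.
  by rewrite mulrAC.
Qed.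

(** Newton's scheme: the correction for a new node is a multiple of the product [q] that vanishes at
    the other nodes. *)
Lemma interpolation (F : fieldType) (xs ys : seq F) :
  uniq xs -> size xs = size ys -> exists p : {poly F}, map (horner p) xs = ys.
Proof.
elim: xs ys => [|x xs IHxs] [|y ys] //=; first by exists 0.
move=> /andP[xxs uxs] [/(IHxs _ uxs) [p pE]].
pose q : {poly F} := \prod_(a <- xs) ('X - a%:P).
have qx : q.[x] != 0 by rewrite -rootE root_prod_XsubC.
exists (p + ((y - p.[x]) / q.[x])%:P * q); congr (_ :: _).
  by rewrite hornerD hornerM hornerC divfK // addrC subrK.
rewrite -pE; apply/eq_in_map => a axs; rewrite hornerD hornerM.
have /rootP -> : root q a by rewrite root_prod_XsubC.
by rewrite mulr0 addr0.
Qed.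

Section Maps.
Variable R : realType.
Implicit Types (f g : polymap R) (z w : pt R) (s t : seq (pt R)) (p q : {poly {poly R[i]}}).

Lemma ord2P (i : 'I_2) : i = ord0 \/ i = ord1.
Proof. by case: i => [[|[|//]] i2]; [left|right]; apply: val_inj. Qed.

(** Dictionary from [mpoly] to iterated polynomials, with both partial derivatives, so that the
    Jacobian can be evaluated where common factors are available. *)
Lemma mpoly_ev (m : {mpoly R[i][2]}) : exists p, forall z,
  [/\ m.@[coords z] = ev z p,
      (mderiv ord0 m).@[coords z] = (p.[z.2%:P])^`().[z.1] &
      (mderiv ord1 m).@[coords z] = ev z p^`()].
Proof.
elim/mpoly_ring_ind: m => [c|i|m n [p pP] [q qP]|m n [p pP] [q qP]].
- exists c%:P%:P => z; rewrite !mderivC !meval0 mevalC hornerC !derivC horner0.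
  by rewrite !ev_simp.
- have [->|->] := ord2P i.
    exists 'X%:P => z; rewrite !mderivXU /=.
    by rewrite meval1 meval0 mevalXU hornerC derivX derivC hornerC !ev_simp.
  exists 'X => z; rewrite !mderivXU /=.
  by rewrite meval1 meval0 mevalXU hornerX derivX derivC horner0 !ev_simp.
- exists (p + q) => z; have [pz pz1 pz2] := pP z; have [qz qz1 qz2] := qP z.
  by rewrite !mderivD !mevalD !hornerD !derivD !hornerD !ev_simp pz qz pz1 qz1 pz2 qz2.
- exists (p * q) => z; have [pz pz1 pz2] := pP z; have [qz qz1 qz2] := qP z.
  rewrite !mderivM !mevalD !mevalM !hornerM !derivM !hornerD !hornerM !ev_simp.
  by rewrite pz qz pz1 qz1 pz2 qz2.
Qed.

Lemma ev_mpoly p : exists m : {mpoly R[i][2]}, forall z, m.@[coords z] = ev z p.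
Proof.
elim/poly_ind: p => [|p c [m mE]].
  by exists 0 => z; rewrite meval0 rmorph0.
have [n nE] : exists n : {mpoly R[i][2]}, forall z, n.@[coords z] = c.[z.1].
  elim/poly_ind: c => [|c a [n nE]]; first by exists 0 => z; rewrite meval0 horner0.
  exists (n * 'X_ord0 + a%:MP) => z.
  by rewrite mevalD mevalM mevalXU mevalC nE hornerMXaddC.
exists (m * 'X_ord1 + n) => z.
by rewrite mevalD mevalM mevalXU mE nE !ev_simp.
Qed.

Lemma jacobianE f : jacobian f =
  mderiv ord0 (f ord0) * mderiv ord1 (f ord1) - mderiv ord1 (f ord0) * mderiv ord0 (f ord1).
Proof. by rewrite /jacobian det_mx22 !mxE. Qed.

(* Infinitely many points in a fibre would give a common factor [h] of the two
   shifted components, and the Jacobian vanishes wherever [h] does. *)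
Lemma keller_finite_fibers f : jac_nonzero_const f ->
  exists P Q, (forall z, evalmap f z = planar P Q z) /\ finite_fibers P Q.
Proof.
move=> [c [c0 jf]]; have [P PE] := mpoly_ev (f ord0); have [Q QE] := mpoly_ev (f ord1).
exists P, Q; split=> [z|[a b]].
  by rewrite /evalmap /planar; have [-> _ _] := PE z; have [-> _ _] := QE z.
have [//|/unlistable_common_factor [h hnc hdvd]] :=
  pselect (listable (fun w => planar P Q w = (a, b))).
have [u uE] : exists u, P - a%:P%:P = u * h.
  by apply: hdvd => z [Pz _]; rewrite !ev_simp Pz subrr.
have [v vE] : exists v, Q - b%:P%:P = v * h.
  by apply: hdvd => z [_ Qz]; rewrite !ev_simp Qz subrr.
have [z hz _] := nonconst_zeros [::] hnc.
have := congr1 (meval (coords z)) jf; rewrite mevalC jacobianE mevalB !mevalM.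
have [_ -> ->] := PE z; have [_ -> ->] := QE z.
(* At a zero of [h] the gradients of [P] and [Q] are [u] and [v] times that of [h], hence
   proportional. *)
have -> : P = u * h + a%:P%:P by rewrite -uE subrK.
have -> : Q = v * h + b%:P%:P by rewrite -vE subrK.
rewrite !derivD !derivC !addr0 !hornerD !hornerC !derivD !derivC !addr0.
rewrite !hornerM !derivM !hornerD !hornerM !ev_simp hz.
rewrite -!evE hz !mulr0 !add0r => jc.
by case/eqP: c0; rewrite -jc; ring.
Qed.

(** * Composition and automorphisms preserving the Jacobian condition *)

Definition polymap_comp f (u : polymap R) : polymap R :=
  fun i => f i \mPo [tuple u j | j < 2].

Lemma evalmap_comp f u z : evalmap (polymap_comp f u) z = evalmap f (evalmap u z).
Proof.
have compE i : (polymap_comp f u i).@[coords z] = (f i).@[coords (evalmap u z)].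
  rewrite [LHS]comp_mpoly_meval; apply: meval_eq => j; rewrite tnth_mktuple.
  by have [->|->] := ord2P j.
exact: congr2 (compE _) (compE _).
Qed.

Lemma jacobian_comp f u : jacobian (polymap_comp f u) =
  (jacobian f \mPo [tuple u j | j < 2]) * jacobian u.
Proof.
rewrite /jacobian -det_map_mx -det_mulmx; congr (\det _); apply/matrixP => i j.
rewrite !mxE mderiv_comp; apply: eq_bigr => k _.
by rewrite !mxE tnth_mktuple.
Qed.

(** Only the effect of precomposition is recorded, so that closure under composition is formal and
    the chain rule enters for single shears alone. *)
Definition keller_auto (phi : pt R -> pt R) :=
  exists psi, [/\ cancel phi psi, cancel psi phi & forall f, jac_nonzero_const f ->
    exists2 g, jac_nonzero_const g & forall z, evalmap g z = evalmap f (phi z)].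

Lemma keller_auto_comp phi1 phi2 :
  keller_auto phi1 -> keller_auto phi2 -> keller_auto (phi1 \o phi2).
Proof.
move=> [psi1 [K1 K1' J1]] [psi2 [K2 K2' J2]]; exists (psi2 \o psi1); split.
- exact: can_comp.
- exact: can_comp.
move=> f /J1 [g /J2 [g' Jg' g'E] gE]; exists g' => // z.
by rewrite g'E gE.
Qed.

Lemma keller_auto_polymap (u : polymap R) phi psi :
    cancel phi psi -> cancel psi phi -> (forall z, evalmap u z = phi z) ->
    jacobian u = 1 -> keller_auto phi.
Proof.
move=> phiK psiK uE ju; exists psi; split=> // f [c [c0 jf]].
exists (polymap_comp f u) => [|z]; last by rewrite evalmap_comp uE.
exists c; split; first exact: c0.
rewrite jacobian_comp.
by move: (jacobian f) (jacobian u) jf ju => _ _ -> ->; rewrite mulr1 comp_mpolyC.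
Qed.

Lemma mpoly_of_poly (h : {poly R[i]}) (k l : 'I_2) : k != l ->
  exists2 H : {mpoly R[i][2]}, mderiv l H = 0 & forall v, H.@[v] = h.[v k].
Proof.
move=> kl; elim/poly_ind: h => [|h a [H dH HE]].
  by exists 0 => [|v]; rewrite ?mderiv0 ?meval0 ?horner0.
exists (H * 'X_k + a%:MP) => [|v].
  by rewrite mderivD mderivM dH mderivXU (negPf kl) mderivC mul0r mulr0 !addr0.
by rewrite mevalD mevalM mevalXU mevalC HE hornerMXaddC.
Qed.

Lemma keller_auto_shear1 (h : {poly R[i]}) : keller_auto (fun z => (z.1 + h.[z.2], z.2)).
Proof.
have [H dH HE] := @mpoly_of_poly h ord1 ord0 isT.
apply: (@keller_auto_polymap
  (fun i => if i == ord0 then 'X_ord0 + H else 'X_ord1) _ (fun z => (z.1 - h.[z.2], z.2))).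
- by case=> x y /=; rewrite addrK.
- by case=> x y /=; rewrite subrK.
- by move=> z; rewrite /evalmap /= mevalD !mevalXU HE.
by rewrite jacobianE /= !mderivD !mderivXU dH /= mulr0 subr0 mulr1 addr0.
Qed.

Lemma keller_auto_shear2 (h : {poly R[i]}) : keller_auto (fun z => (z.1, z.2 + h.[z.1])).
Proof.
have [H dH HE] := @mpoly_of_poly h ord0 ord1 isT.
apply: (@keller_auto_polymap
  (fun i => if i == ord0 then 'X_ord0 else 'X_ord1 + H) _ (fun z => (z.1, z.2 - h.[z.1]))).
- by case=> x y /=; rewrite addrK.
- by case=> x y /=; rewrite subrK.
- by move=> z; rewrite /evalmap /= mevalD !mevalXU HE.
by rewrite jacobianE /= !mderivD !mderivXU dH /= mul0r subr0 mul1r addr0.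
Qed.

(** * Moving finite sets of points by shears *)

Definition moves s t := exists2 phi, keller_auto phi & map phi s = t.

Lemma moves_trans s t r : moves s t -> moves t r -> moves s r.
Proof.
move=> [phi1 A1 <-] [phi2 A2 <-]; exists (phi2 \o phi1); first exact: keller_auto_comp.
exact: map_comp.
Qed.

(** Since the abscissas are distinct, the required vertical displacements can be interpolated by a
    polynomial in the abscissa. *)
Lemma moves_snd s ys : uniq (unzip1 s) -> size s = size ys ->
  moves s (zip (unzip1 s) ys).
Proof.
move=> us sys.
have [|h hE] := @interpolation _ (unzip1 s) [seq u.2 - u.1.2 | u <- zip s ys] us.
  by rewrite !size_map size_zip sys minnn.
exists (fun z => (z.1, z.2 + h.[z.1])); first exact: keller_auto_shear2.
elim: s ys sys hE {us} => [|[a b] s IHs] [|y ys] //= [sys] [hE /IHs ->] //.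
by rewrite hE addrC subrK.
Qed.

Lemma moves_fst s xs : uniq (unzip2 s) -> size s = size xs ->
  moves s (zip xs (unzip2 s)).
Proof.
move=> us sxs.
have [|h hE] := @interpolation _ (unzip2 s) [seq u.2 - u.1.1 | u <- zip s xs] us.
  by rewrite !size_map size_zip sxs minnn.
exists (fun z => (z.1 + h.[z.2], z.2)); first exact: keller_auto_shear1.
elim: s xs sxs hE {us} => [|[a b] s IHs] [|x xs] //= [sxs] [hE /IHs ->] //.
by rewrite hE addrC subrK.
Qed.

Lemma keller_auto_shear a : keller_auto (shear a).
Proof.
have := keller_auto_shear1 (a%:P * 'X); congr keller_auto.
by apply/funext => z; rewrite hornerM hornerC hornerX.
Qed.

(** The difference of the sheared abscissas of two distinct points is a nonzero polynomial in [a] of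
    degree at most 1; [a] avoids the roots of all of them. *)
Lemma shear_uniq_fst s : uniq s -> exists a : R[i], uniq (unzip1 (map (shear a) s)).
Proof.
move=> us; pose d (u : pt R * pt R) : {poly R[i]} :=
  (u.1.1 - u.2.1)%:P + (u.1.2 - u.2.2)%:P * 'X.
have : \prod_(u <- [seq (z, w) | z <- s, w <- s] | u.1 != u.2) d u != 0.
  rewrite prodf_seq_neq0; apply/allP => -[z w] _ /=; apply/implyP; apply: contra => /eqP dzw.
  have := congr1 (fun p : {poly R[i]} => p`_0) dzw.
  have := congr1 (fun p : {poly R[i]} => p`_1) dzw.
  rewrite !coefD !coefMX !coefC /= add0r addr0 => /eqP; rewrite subr_eq0 => /eqP e2.
  move=> /eqP; rewrite subr_eq0 => /eqP e1.
  by rewrite [z]surjective_pairing [w]surjective_pairing e1 e2.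
case/closed_nonrootP => a da; exists a.
rewrite /unzip1 -map_comp map_inj_in_uniq // => z w zs ws zw.
apply: contraNeq da => /= z_w; rewrite rootE horner_prod prodf_seq_eq0.
apply/hasP; exists (z, w); first by apply/allpairsP; exists (z, w).
rewrite /= z_w /= /d hornerD hornerM !hornerC hornerX /=.
move: zw; rewrite /shear /= => /eqP; rewrite -subr_eq0 => /eqP zw.
by apply/eqP; rewrite -[RHS]zw; ring.
Qed.

(** After shears making abscissas distinct, the points of [s1] go vertically to the diagonal, then
    horizontally to the abscissas of [t1], then vertically to [t1]; the shear of [t] is finally
    undone. *)
Lemma moves_uniq s t : uniq s -> uniq t -> size s = size t -> moves s t.
Proof.
move=> us ut st; have [a ua] := shear_uniq_fst us; have [b ub] := shear_uniq_fst ut.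
set s1 := map (shear a) s in ua; set t1 := map (shear b) t in ub.
pose xs := unzip1 s1; pose xs' := unzip1 t1.
have [ss1 st1] : size xs = size s /\ size xs' = size s by rewrite !size_map.
apply: (@moves_trans _ s1); first by exists (shear a); first exact: keller_auto_shear.
apply: (@moves_trans _ (zip xs xs)); first by apply: moves_snd; rewrite ?ss1 ?size_map.
apply: (@moves_trans _ (zip xs' xs)).
  have := @moves_fst (zip xs xs) xs'; rewrite unzip2_zip //; apply=> //.
  by rewrite size_zip minnn ss1.
apply: (@moves_trans _ t1); last first.
  exists (shear (- b)); first exact: keller_auto_shear.
  by rewrite mapK //; exact: shearK.
have -> : t1 = zip (unzip1 (zip xs' xs)) (unzip2 t1).
  by rewrite unzip1_zip ?ss1 ?st1 // zip_unzip.
apply: moves_snd; first by rewrite unzip1_zip ?ss1 ?st1.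
by rewrite size_zip ss1 st1 minnn !size_map.
Qed.

End Maps.

(** * Equivalence of the two assertions *)

Theorem theorem2 (R : realType) : assertionA R <-> assertionB R.
Proof.
split=> [A f Om jf _ _ z w _ _|B f jf].
  by have [_ [g [fK _]]] := A f jf; apply: can_inj fK z w.
have [P [Q [fE finF]]] := keller_finite_fibers jf.
have [mulF|mulF] := pselect (listable (multiple_value P Q)).
  have [G1 [G2 [FK GK]]] := finite_fibers_inverse finF mulF.
  have [m1 m1E] := ev_mpoly G1; have [m2 m2E] := ev_mpoly G2.
  pose g : polymap R := fun i => if i == ord0 then m1 else m2.
  have gE z : evalmap g z = planar G1 G2 z by rewrite /evalmap /g /= m1E m2E.
  have fK : cancel (evalmap f) (evalmap g) by move=> z; rewrite fE gE FK.
  have gK : cancel (evalmap g) (evalmap f) by move=> z; rewrite fE gE GK.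
  by split; [exists (evalmap g)|exists g].
(* [Om] is the image of [F], and [s] lists exactly the missed points, without repetition, so that
   they can be moved. *)
pose F := evalmap f; pose Om z := exists w, F w = z.
have [s us sP] : exists2 s, uniq s & forall z, z \in s <-> ~ Om z.
  have [s sS] := finite_fibers_coimage finF.
  exists [seq z <- undup s | `[< ~ Om z >]]; first by rewrite filter_uniq ?undup_uniq.
  move=> z; rewrite mem_filter mem_undup; split=> [/andP[/asboolP //]|nz].
  rewrite sS ?andbT; first exact/asboolP.
  by apply: contra_not nz => -[w wz]; exists w; rewrite /F fE.
(* [c] holds as many multiple values as there are missed points; [ps] will hold one chosen preimage
   of each. *)
have [c [uc sc cE]] := unlistable_uniq (size s) mulF.
have [z|p pP] := @choice _ _ (fun z (w : pt R * pt R) => multiple_value P Q z ->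
    [/\ w.1 != w.2, F w.1 = z & F w.2 = z]).
  have [[w [w' [ww' wz w'z]]]|nz] := pselect (multiple_value P Q z).
    by exists (w, w') => _; rewrite /F !fE.
  by exists (z, z).
pose ps := [seq (p z).1 | z <- c].
have FpsP w : w \in ps -> F w \in c /\ w = (p (F w)).1.
  by case/mapP => z zc ->; have [_ -> _] := pP z (cE z zc).
have ups : uniq ps.
  rewrite map_inj_in_uniq // => z1 z2 /cE/pP[_ + _] /cE/pP[_ + _] e12.
  by rewrite e12 => -> ->.
have [|phi [psi [phiK psiK]] /(_ f jf) [g jg gE] phis] := moves_uniq us ups.
  by rewrite size_map sc.
have psiOm w : w \notin ps -> Om (psi w).
  move=> wps; apply: contraNP wps => /sP psiw.
  by rewrite -phis; apply/mapP; exists (psi w); rewrite ?psiK.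
have imOm : image_eq (evalmap g) Om.
  move=> z; split=> [[w wz]|[w [_ <-]]]; last by exists (phi w); rewrite gE.
  (* If [w] is in [ps], then [psi w] is a missed point; the second preimage of the same value
     replaces [w], as [ps] contains only one preimage of each value. *)
  have [wps|wps] := boolP (w \in ps); last first.
    by exists (psi w); rewrite gE psiK; split; first exact: psiOm.
  have [] := FpsP w wps; rewrite wz => /cE zE wp; have [p12 _ p2] := pP z zE.
  exists (psi (p z).2); rewrite gE psiK; split=> //; apply: psiOm.
  by apply: contra p12 => /FpsP [_]; rewrite p2 => ->.
(* A further multiple value outside [c] has no preimage in [ps], so [psi] carries its two chosen
   preimages into [Om], where [g] identifies them. *)
have [z zE zc] := unlistable_notin c mulF.
have [p12 p1 p2] := pP z zE.
have outside w : F w = z -> Om (psi w).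
  by move=> wz; apply: psiOm; apply: contra zc => /FpsP []; rewrite wz.
have cofOm : cofinite Om by exists s => y /sP.
case/eqP: p12; apply: (can_inj psiK).
by apply: (B g Om jg cofOm imOm); rewrite ?gE ?psiK -/(F _) ?p1 ?p2 //; apply: outside.
Qed.
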